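(* Let $G$ be a path graph with $n$ nodes, identified as $1,2,\dots,n$ in order along the path, and let $S=\{s_1,\dots,s_k\}$, $s_1<\dots<s_k$, be a set of $k\geq 2$ noise-free leaders. Let $c$ be the $(k+1)$-vector with $c_1=s_1-1$, $c_{k+1}=n-s_k$, and $c_i=s_i-s_{i-1}$ for $i=2,\dots,k$. Then: 1. The coherence of $G$ is $$ R_{NF}(S)=\frac14\left(c_1^2+c_{k+1}^2+c_1+c_{k+1}\right)+\frac1{12}\sum_{i=2}^k (c_i^2-1). $$ 2. Let $n$ be such that, for the optimal leader configuration, it holds that $c_1+c_{k+1}=a$ where $2$ divides $a$, and $(k-1)$ divides $b=(n-1)-a$. Then the optimal solution to the $k$-leader selection problem (for noise-free leaders) is given by $$ c_1=c_{k+1}=\operatorname{round}\left(\frac{2(n-1)-3(k-1)}{6(k-1)+4}\right), $$ $$ c_i=\frac1{k-1}\left((n-1)-2c_1\right),\qquad i=2,\dots,k. $$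
   Context: All edge weights equal $1$. $\operatorname{round}(\cdot)$ denotes rounding to the nearest integer. For a connected graph with Laplacian $L$ and nonempty leader set $S\subseteq V$, let $L_{ff}$ be the principal submatrix of $L$ indexed by $V\setminus S$. The coherence for noise-free leaders $S$ (total steady-state variance of the followers under $\dot x_f=-L_{ff}x_f+d_f$, with $d_f$ a vector of zero-mean unit-variance white noise processes) is $$R_{NF}(S)=\tfrac12\operatorname{tr}(L_{ff}^{-1}),$$ with value $0$ if $S=V$. The noise-free $k$-leader selection problem is to minimize $R_{NF}(S)$ over (nonempty) $S\subseteq V$ with $|S|\le k$; ''the optimal leader configuration'' is the vector $c$ of an optimal solution. *)

(* Defs.v *)
From HB Require Import structures.
From mathcomp Require Import all_boot all_order all_algebra.

Set Implicit Arguments.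
Unset Strict Implicit.
Unset Printing Implicit Defensive.

Import Order.TTheory GRing.Theory Num.Theory.
Local Open Scope ring_scope.

Definition path_graph (n : nat) : rel 'I_n :=
  fun u v => (u.+1 == v) || (v.+1 == u).

(* Graphs are simple and undirected: the relation [e] is meant to be symmetric
   and irreflexive. *)
Definition laplacian (R : pzRingType) (n : nat) (e : rel 'I_n) : 'M[R]_n :=
  diag_mx (\row_v #|[set w | e v w]|%:R) - \matrix_(v, w) (e v w)%:R.

Definition follower_laplacian (R : pzRingType) (n : nat) (e : rel 'I_n)
    (S : {set 'I_n}) : 'M[R]_#|~: S| :=
  mxsub enum_val enum_val (laplacian R e).

(* Meaningful for ordered [R], connected [e] and nonempty [S]: the matrix is then
   invertible, whereas [invmx] is the identity map on singular matrices. *)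
Definition coherence (R : fieldType) (n : nat) (e : rel 'I_n)
    (S : {set 'I_n}) : R :=
  2^-1 * \tr (invmx (follower_laplacian R e S)).

Lemma coherence_setT (R : fieldType) (n : nat) (e : rel 'I_n) :
  coherence R e [set: 'I_n] = 0.
Proof.
rewrite /coherence /mxtrace big1 ?mulr0 // => i _.
by have := ltn_ord i; rewrite [X in (_ < X)%N]cardsCs setCK cardsT subnn.
Qed.

Definition optimal_leaders (R : realFieldType) (n : nat) (e : rel 'I_n)
    (k : nat) (S : {set 'I_n}) : Prop :=
  (0 < #|S| <= k)%N /\
  forall S' : {set 'I_n}, (0 < #|S'| <= k)%N ->
    coherence R e S <= coherence R e S'.

(* Nodes of the path are numbered from 1: the ordinal [v] is node [v.+1]. *)
Definition leaders (n : nat) (S : {set 'I_n}) : seq nat :=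
  [seq (val v).+1 | v <- enum S].

Lemma leaders_sorted (n : nat) (S : {set 'I_n}) : sorted ltn (leaders S).
Proof.
rewrite /leaders sorted_map; apply: (subseq_sorted _ (filter_subseq _ _)).
  by move=> x y z /=; exact: ltn_trans.
rewrite -enumT -[relpre _ _]/(relpre val ltn) -sorted_map val_enum_ord.
exact: iota_ltn_sorted.
Qed.

(* [leader S i] is s_i and [config S i] is c_i, with i counted from 1: s_i for
   1 <= i <= #|S|, c_i for 1 <= i <= #|S|.+1. *)
Definition leader (n : nat) (S : {set 'I_n}) (i : nat) : nat :=
  nth 0%N (leaders S) i.-1.

Definition config (n : nat) (S : {set 'I_n}) (i : nat) : nat :=
  if i == 1%N then (leader S 1 - 1)%N
  else if i == #|S|.+1 then (n - leader S #|S|)%N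
  else (leader S i - leader S i.-1)%N.

(* Halves are rounded up. *)
Definition round (R : archiRealFieldType) (x : R) : int :=
  Num.floor (x + 2^-1).

(* Main.v *)
Require Import Defs.
From HB Require Import structures.
From mathcomp Require Import all_boot all_order all_algebra.
From mathcomp Require Import zify ring lra.

Set Implicit Arguments.
Unset Strict Implicit.
Unset Printing Implicit Defensive.

Import Order.TTheory GRing.Theory Num.Theory.
Local Open Scope ring_scope.

(** The coherence formula is an electrical computation.  The diagonal entry of
    the inverse follower Laplacian at a follower [v] is the potential at [v]
    when the leaders are grounded and a unit current enters at [v]
    ([trace_follower]).  On a path the current sees only the leaders next to
    [v], and the potential is a tent: it grows linearly from the left leader up
    to [v] and decreases linearly to the right one, and it is flat on a side
    without leader ([tent_potential]).  The height of the tent is thus the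
    distance to the leader in an end segment, and
    (j - s)(s' - j) / (s' - s) between two leaders.  Summing the heights over
    each segment gives c (c + 1) / 2 for an end of length c and (c^2 - 1) / 6
    for a gap of length c ([coherence_path]).

    The optimization is then a problem on natural numbers: every choice of end
    lengths [x], [y] and positive gaps [w] with the right total is realized by
    a leader set ([profile_exists]), and its coherence is [cost x w y] / 12.

    - Splitting a segment lowers the cost, so that an optimal solution uses all
      [k] leaders ([minimal_size]).
    - By convexity, under the two divisibility hypotheses the configuration with
      equal ends [x] and equal gaps [c] costs no more than the given optimal one
      and is optimal too ([minimal_balanced]).
    - Moving one unit between an end and a gap cannot improve it, which forces
      3 x <= c <= 3 x + 3 ([minimal_gap_bounds]).
    - These bounds say that the real minimizer of the cost of balanced
      configurations is within 1/2 of [x], hence rounds to [x]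
      ([round_balanced]).
    - They also make [2 c] a Lagrange multiplier for the total length: after
      subtracting [2 c] times the length, each term of the cost is minimal at
      the balanced configuration, which is therefore the only optimal one
      ([balanced_cost_min]). *)

(** * Grounded potentials and the trace of the inverse *)

Definition unit_potential (R : pzRingType) (n : nat) (e : rel 'I_n)
    (S : {set 'I_n}) (v : 'I_n) (g : 'I_n -> R) : Prop :=
  (forall u, u \in S -> g u = 0) /\
  (forall u, u \notin S -> \sum_(w | e u w) (g u - g w) = (u == v)%:R).

Lemma laplacian_action (R : pzRingType) (n : nat) (e : rel 'I_n)
    (g : 'I_n -> R) (u : 'I_n) :
  \sum_w laplacian R e u w * g w = \sum_(w | e u w) (g u - g w).
Proof.
under eq_bigr => w _ do rewrite !mxE mulrBl.
rewrite !sumrB; congr (_ - _).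
  rewrite (bigD1 u) //= eqxx mulr1n big1 ?addr0 => [|w /negPf wu]; last first.
    by rewrite eq_sym wu mulr0n mul0r.
  by rewrite sumr_const mulr_natl cardsE.
by rewrite [RHS]big_mkcond; apply: eq_bigr => w _; case: (e u w); rewrite ?mul1r ?mul0r.
Qed.

(** The potentials of unit currents are the columns of a right inverse of the
    follower Laplacian: since they vanish on [S], cutting the Laplacian down to
    the followers loses nothing. *)
Lemma trace_follower (R : fieldType) (n : nat) (e : rel 'I_n)
    (S : {set 'I_n}) (h : 'I_n -> R) :
  (forall v, v \notin S -> exists2 g, unit_potential e S v g & g v = h v) ->
  \tr (invmx (follower_laplacian R e S)) = \sum_(v in ~: S) h v.
Proof.
move=> hP.
have /fin_all_exists [G GP] (i : 'I_#|~: S|) :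
    exists g, unit_potential e S (enum_val i) g /\ g (enum_val i) = h (enum_val i).
  have := enum_valP i; rewrite inE => /hP [g ? ?]; by exists g.
pose M : 'M[R]_#|~: S| := \matrix_(j, i) G i (enum_val j).
have LM : follower_laplacian R e S *m M = 1%:M.
  apply/matrixP => j i; have [[G0 G1] _] := GP i.
  have jS : enum_val j \notin S by have := enum_valP j; rewrite inE.
  rewrite !mxE -(inj_eq enum_val_inj) -G1 // -laplacian_action.
  rewrite [RHS](bigID (mem (~: S))) /= [X in _ + X]big1 => [|w]; last first.
    by rewrite inE negbK => wS; rewrite G0 ?mulr0.
  by rewrite addr0 [RHS]big_enum_val; apply: eq_bigr => l _; rewrite !mxE.
have -> : invmx (follower_laplacian R e S) = M.
  have [uL _] := mulmx1_unit LM.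
  by rewrite -[M](mulKmx uL) LM mulmx1.
rewrite /mxtrace [RHS]big_enum_val; apply: eq_bigr => i _.
by rewrite mxE; have [_ ->] := GP i.
Qed.

(** * Potentials on a path *)

(** The vertex [u] has number [u.+1], so its neighbours have numbers [u] and
    [u.+2]; stating the sum on numbers turns potentials into functions on
    [nat]. *)
Lemma path_graph_sum (R : nmodType) (n : nat) (u : 'I_n) (F : nat -> R) :
  \sum_(w | path_graph u w) F w.+1 =
    (if (1 < u.+1)%N then F u else 0) + (if (u.+1 < n)%N then F u.+2 else 0).
Proof.
rewrite (bigID (fun w : 'I_n => (w.+1 == u)%N)) /=; congr (_ + _).
  case: ifP => u0.
    have lt_u : (u.-1 < n)%N by have := ltn_ord u; lia.
    rewrite (big_pred1 (Ordinal lt_u)) /= ?prednK // => w.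
    by rewrite /path_graph /= -val_eqE /=; lia.
  by rewrite big_pred0 // => w; rewrite /path_graph; lia.
case: ifP => un.
  rewrite (big_pred1 (Ordinal un)) //= => w.
  by rewrite /path_graph /= -val_eqE /=; lia.
by rewrite big_pred0 // => w; rewrite /path_graph; have := ltn_ord w; lia.
Qed.

(** The tent has slopes [p] and [- q] on the two sides of [v], and the unit
    current splits as [p + q = 1].  A side without leader is a segment bounded
    by the virtual node number [0] or [n.+1]; no current flows there and the
    slope is zero. *)
Lemma tent_potential (R : fieldType) (n : nat) (S : {set 'I_n}) (v : 'I_n)
    (a b : nat) (p q h : R) :
    (a < v.+1 < b)%N -> 
    (forall u : 'I_n, u \in S -> (u.+1 <= a)%N || (b <= u.+1)%N) ->
    (a = 0%N /\ p = 0) \/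
      (exists2 u : 'I_n, u \in S & a = u.+1 /\ h = p * (v.+1%:R - a%:R)) ->
    (b = n.+1 /\ q = 0) \/
      (exists2 u : 'I_n, u \in S & b = u.+1 /\ h = q * (b%:R - v.+1%:R)) ->
    p + q = 1 ->
  exists2 g, unit_potential (@path_graph n) S v g & g v = h.
Proof.
move=> avb gapS lft rgt pq.
pose g (j : nat) : R :=
  if (a < j < b)%N then
    if (j <= v.+1)%N then h - p * (v.+1%:R - j%:R) else h - q * (j%:R - v.+1%:R)
  else 0.
exists (fun u : 'I_n => g u.+1); last first.
  by rewrite /g avb leqnn subrr mulr0 subr0.
split=> u uS.
  by rewrite /g; case: ifP => // /andP[]; have := gapS _ uS; lia.
rewrite (path_graph_sum u (fun j => g u.+1 - g j)).
have un := ltn_ord u; have vn := ltn_ord v.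
have neq_a : a != u.+1.
  apply: contraNneq uS => au; case: lft => [[]|[w wS [aw _]]]; first lia.
  by rewrite (_ : u = w) //; apply: val_inj => /=; lia.
have neq_b : b != u.+1.
  apply: contraNneq uS => bu; case: rgt => [[]|[w wS [bw _]]]; first lia.
  by rewrite (_ : u = w) //; apply: val_inj => /=; lia.
have [uab|uab] := boolP (a < u.+1 < b)%N; last first.
  have g0 j : (a < j < b)%N = false -> g j = 0 by rewrite /g => ->.
  rewrite !g0 ?subrr; try lia.
  rewrite !if_same addr0.
  by have /negPf-> : u != v by apply: contraNneq uab => ->.
(* The net current leaving [u] to the left, then to the right. *)
have -> : (if (1 < u.+1)%N then g u.+1 - g u else 0) = if (u <= v)%N then p else - q.
  case: ltnP => u1; last first.
    case: lft => [[a0 ->]|[w _ [aw _]]]; last by lia.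
    by rewrite ifT //; lia.
  rewrite {1}/g uab ltnS /g; have [lt_au|le_ua] := ltnP a u.
    have -> /= : (u < b)%N by lia.
    rewrite -[u.+1]addn1 -[v.+1]addn1 !natrD; case: (leqP u v) => uv.
      by rewrite ifT; [ring | lia].
    case: leqP => uv'; last by ring.
    have -> : (u : nat) = v.+1 by lia.
    rewrite -[v.+1]addn1 !natrD; ring.
  have ua : a = u by lia.
  rewrite /= !ifT; try lia.
  case: lft => [[]|[w _ [_ ->]]]; first by lia.
  rewrite ua -[u.+1]addn1 -[v.+1]addn1 !natrD; ring.
have -> : (if (u.+1 < n)%N then g u.+1 - g u.+2 else 0) = if (u < v)%N then - p else q.
  case: ltnP => u1; last first.
    case: rgt => [[b0 ->]|[w _ [bw _]]]; last by have := ltn_ord w; lia.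
    by rewrite ifF //; lia.
  rewrite {1}/g uab ltnS /g; have [lt_ub|le_bu] := ltnP u.+2 b.
    have -> /= : (a < u.+2)%N by lia.
    case: (ltnP u v) => uv.
      by rewrite !ifT; [rewrite -!natr1; ring | lia..].
    rewrite [X in _ - X]ifF; last by lia.
    case: leqP => uv'; last by rewrite -!natr1; ring.
    have -> : (u : nat) = v by lia.
    rewrite -!natr1; ring.
  have ub : b = u.+2 by lia.
  rewrite andbF /=.
  case: rgt => [[]|[w _ [_ ->]]]; first by lia.
  rewrite [in RHS]ifF; last by lia.
  rewrite ub -!natr1.
  case: leqP => uv; last by ring.
  have -> : (u : nat) = v by lia.
  ring.
rewrite -val_eqE /=.
by case: ltngtP => _; rewrite ?subrr ?addNr ?pq.
Qed.

(** * Segments between leaders *)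

Lemma size_leaders (n : nat) (S : {set 'I_n}) : size (leaders S) = #|S|.
Proof. by rewrite size_map cardE. Qed.

Lemma mem_leaders (n : nat) (S : {set 'I_n}) (v : 'I_n) :
  (v.+1 \in leaders S) = (v \in S).
Proof.
by rewrite (mem_map (f := fun u : 'I_n => u.+1)) ?mem_enum // => x y [/val_inj].
Qed.

Lemma leader_vertex (n : nat) (S : {set 'I_n}) (i : nat) :
  (0 < i <= #|S|)%N -> exists2 u : 'I_n, u \in S & leader S i = u.+1.
Proof.
move=> im; have : leader S i \in leaders S by rewrite mem_nth // size_leaders; lia.
by case/mapP=> u; rewrite mem_enum => uS ->; exists u.
Qed.

Lemma vertex_leader (n : nat) (S : {set 'I_n}) (u : 'I_n) :
  u \in S -> exists2 i, (0 < i <= #|S|)%N & leader S i = u.+1.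
Proof.
rewrite -mem_leaders => /(nthP 0%N) [i]; rewrite size_leaders => im eq_u.
by exists i.+1.
Qed.

Lemma leader_mono (n : nat) (S : {set 'I_n}) (i j : nat) :
  (0 < i)%N -> (i < j <= #|S|)%N -> (leader S i < leader S j)%N.
Proof.
move=> i0 ij; apply: (sorted_ltn_nth ltn_trans 0%N (leaders_sorted S));
  rewrite ?inE ?size_leaders; lia.
Qed.

Lemma leader_homo (n : nat) (S : {set 'I_n}) (i j : nat) :
  (0 < i)%N -> (i <= j <= #|S|)%N -> (leader S i <= leader S j)%N.
Proof.
move=> i0 /andP[]; rewrite leq_eqVlt => /predU1P[-> //|ij jm].
by apply/ltnW/leader_mono; rewrite ?ij.
Qed.

Lemma leader_bounds (n : nat) (S : {set 'I_n}) (i : nat) :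
  (0 < i <= #|S|)%N -> (0 < leader S i <= n)%N.
Proof. by case/leader_vertex => u _ ->; rewrite ltn_ord. Qed.

Lemma leader_le (n : nat) (S : {set 'I_n}) (i : nat) :
  (0 < i <= #|S|)%N -> (leader S i <= n)%N.
Proof. by case/leader_bounds/andP. Qed.

(** Segment [i] consists of the numbers in [[gap_start i, gap_start i.+1[].
    A leader opens the segment on its right, so that the half-open intervals
    partition the numbers from [1] to [n]; segments [0] and [#|S|] are the two
    ends. *)
Definition gap_start (n : nat) (S : {set 'I_n}) (i : nat) : nat :=
  if i == 0%N then 1%N else if (i <= #|S|)%N then leader S i else n.+1.

Lemma gap_start_homo (n : nat) (S : {set 'I_n}) :
  {homo gap_start S : i j / (i <= j)%N}.
Proof.
apply: (homo_leq leqnn leq_trans) => i; rewrite /gap_start.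
case: (posnP i) => [->|i0] /=.
  by case: ifP => // m0; have /andP[] := @leader_bounds n S 1 m0.
have [im|mi] := leqP i.+1 #|S|.
  by rewrite (ltnW im); apply: leader_homo; rewrite // leqnSn.
case: ifP => // im; by apply/leqW/leader_le; rewrite i0.
Qed.

Lemma gap_uniq (n : nat) (S : {set 'I_n}) (i i' j : nat) :
  (gap_start S i <= j < gap_start S i.+1)%N ->
  (gap_start S i' <= j < gap_start S i'.+1)%N -> i = i'.
Proof.
move=> gi gi'; case: (ltngtP i i') => // lt_i.
  by have := gap_start_homo S lt_i; lia.
by have := gap_start_homo S lt_i; lia.
Qed.

Lemma gap_exists (n : nat) (S : {set 'I_n}) (j : nat) : (0 < j <= n)%N ->
  exists2 i, (i < #|S|.+1)%N & (gap_start S i <= j < gap_start S i.+1)%N.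
Proof.
move=> /andP[j0 jn].
have : (j < gap_start S #|S|.+1)%N by rewrite /gap_start /= ltnn ltnS.
elim: #|S|.+1 => [|m IHm]; first by rewrite /gap_start /=; lia.
have [/IHm [i im gi] _|le_j lt_j] := ltnP j (gap_start S m).
  by exists i; rewrite // ltnW.
by exists m; rewrite ?le_j.
Qed.

(** The resistance between node number [j] of segment [i] and the grounded
    leaders. *)
Definition resistance (R : fieldType) (n : nat) (S : {set 'I_n})
    (i j : nat) : R :=
  if i == 0%N then (leader S 1)%:R - j%:R
  else if i == #|S| then j%:R - (leader S i)%:R
  else (j%:R - (leader S i)%:R) * ((leader S i.+1)%:R - j%:R)
         / ((leader S i.+1)%:R - (leader S i)%:R).

Lemma gap_potential (R : numFieldType) (n : nat) (S : {set 'I_n}) (i : nat)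
    (v : 'I_n) :
  (0 < #|S|)%N -> v \notin S -> (i <= #|S|)%N ->
  (gap_start S i <= v.+1 < gap_start S i.+1)%N ->
  exists2 g, unit_potential (@path_graph n) S v g & g v = resistance R S i v.+1.
Proof.
move=> m0 vS im; rewrite /gap_start /resistance.
have lead_v l : (0 < l <= #|S|)%N -> leader S l != v.+1.
  case/leader_vertex => u uS ->; apply: contraNneq vS => - [] /val_inj <-.
  exact: uS.
case: (posnP i) => [->|i0] /=.
  rewrite m0 => lt_v; have lv := lead_v 1%N m0.
  have [s1 s1S s1E] := @leader_vertex n S 1 m0.
  apply: (@tent_potential _ _ _ _ 0 (leader S 1) 0 1); rewrite ?add0r //.
  - by move=> u /vertex_leader [l lm <-]; rewrite orbC leader_homo //; lia.
  - by left.
  - by right; exists s1; rewrite // mul1r.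
have [si siS siE] : exists2 u : 'I_n, u \in S & leader S i = u.+1.
  by apply: leader_vertex; lia.
have vi : leader S i != v.+1 by apply: lead_v; lia.
rewrite im; case: (ltngtP i #|S|) im => // im _.
  have vi1 : leader S i.+1 != v.+1 by apply: lead_v; lia.
  have [sj sjS sjE] : exists2 u : 'I_n, u \in S & leader S i.+1 = u.+1.
    by apply: leader_vertex; lia.
  move=> lt_v; have := @leader_mono n S i i.+1 i0.
  rewrite ltnSn im /= -(ltr_nat R) -subr_gt0 => /(_ isT) c_gt0.
  set a : R := (leader S i)%:R in c_gt0 *.
  set b : R := (leader S i.+1)%:R in c_gt0 *.
  apply: (@tent_potential _ _ _ _ (leader S i) (leader S i.+1)
           ((b - v.+1%:R) / (b - a)) ((v.+1%:R - a) / (b - a))).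
  - by lia.
  - move=> u /vertex_leader [l lm <-]; have [li|il] := leqP l i.
      by rewrite leader_homo //; lia.
    by rewrite orbC leader_homo //; lia.
  - right; exists si => //; split=> //; rewrite -?/a -?/b; ring.
  - right; exists sj => //; split=> //; rewrite -?/a -?/b; ring.
  - by rewrite -mulrDl addrA subrK divff ?gt_eqF.
move=> lt_v; apply: (@tent_potential _ _ _ _ (leader S i) n.+1 1 0); rewrite ?addr0 //.
- by have := ltn_ord v; lia.
- by move=> u /vertex_leader [l lm <-]; rewrite leader_homo //; lia.
- by right; exists si; rewrite // mul1r.
- by left.
Qed.

(** The leaders may be added to the sum over the followers, because the leader
    that opens a segment has resistance zero. *)
Lemma trace_path (R : numFieldType) (n : nat) (S : {set 'I_n}) :
  (0 < #|S|)%N ->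
  \tr (invmx (follower_laplacian R (@path_graph n) S)) =
  \sum_(0 <= i < #|S|.+1)
     \sum_(gap_start S i <= j < gap_start S i.+1) resistance R S i j.
Proof.
move=> m0.
pose in_gap i j := (gap_start S i <= j < gap_start S i.+1)%N.
pose h j : R := \sum_(0 <= i < #|S|.+1 | in_gap i j) resistance R S i j.
have hE i j : (i <= #|S|)%N -> in_gap i j -> h j = resistance R S i j.
  move=> im gi; rewrite /h big_mkord (big_pred1 (Ordinal (im : i < #|S|.+1)%N)) //.
  move=> i' /=; rewrite -val_eqE /=; apply/idP/eqP => [gi'|-> //].
  exact: gap_uniq gi' gi.
rewrite (@trace_follower _ _ _ _ (fun v : 'I_n => h v.+1)) => [|v vS]; last first.
  have [|i im gi] := @gap_exists n S v.+1; first by rewrite ltn_ord.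
  by rewrite (hE i) //; apply: gap_potential.
have h0 (v : 'I_n) : v \in S -> h v.+1 = 0.
  case/vertex_leader => i /andP[i0 im] iE.
  have gi : in_gap i v.+1.
    rewrite /in_gap /gap_start -iE gtn_eqF // im leqnn /=; case: ifP => im1.
      by apply: leader_mono; rewrite ?ltnSn.
    by rewrite ltnS leader_le ?i0.
  rewrite (hE i) // /resistance gtn_eqF // iE subrr mul0r mul0r.
  by case: eqP.
transitivity (\sum_(v < n) h v.+1).
  rewrite [RHS](bigID (mem S)) /= [in RHS]big1 ?add0r => [|v /h0 //].
  by apply: eq_bigl => v; rewrite inE.
rewrite -(big_mkord xpredT (fun v => h v.+1)) -(big_add1 _ _ 0 n.+1 xpredT h).
rewrite (exchange_big_dep_nat xpredT) //=; apply: eq_big_nat => i im.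
rewrite [RHS](big_nat_widenl _ 1) ?(@gap_start_homo n S 0) // [RHS](big_nat_widen _ _ n.+1).
  by apply: eq_bigl => j; rewrite /in_gap.
by have := @gap_start_homo n S i.+1 #|S|.+1 im; rewrite {2}/gap_start /= ltnn.
Qed.

(** * The coherence formula *)

Lemma sum_ramp (R : numFieldType) (c : nat) :
  \sum_(0 <= t < c.+1) t%:R = (c%:R ^+ 2 + c%:R) / 2 :> R.
Proof.
elim: c => [|c IHc]; first by rewrite big_nat1; field.
by rewrite big_nat_recr //= IHc -natr1; field.
Qed.

Lemma sum_parabola (R : numFieldType) (c : nat) : (0 < c)%N ->
  \sum_(0 <= t < c) t%:R * (c%:R - t%:R) / c%:R = (c%:R ^+ 2 - 1) / 6 :> R.
Proof.
move=> c0; rewrite -mulr_suml.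
(* The bound of summation is separated from [c] to allow induction on it. *)
have partial (m : nat) (x : R) : \sum_(0 <= t < m) t%:R * (x - t%:R) =
    x * (m%:R * (m%:R - 1)) / 2 - m%:R * (m%:R - 1) * (2 * m%:R - 1) / 6.
  elim: m => [|m IHm]; first by rewrite big_geq //; field.
  by rewrite big_nat_recr //= IHm -natr1; field.
rewrite partial; field; by rewrite pnatr_eq0 -lt0n.
Qed.

Lemma coherence_path (R : realFieldType) (n : nat) (S : {set 'I_n}) :
    (0 < #|S|)%N ->
  let c i : R := (config S i)%:R in
  coherence R (@path_graph n) S =
    4^-1 * (c 1%N ^+ 2 + c #|S|.+1 ^+ 2 + c 1%N + c #|S|.+1)
    + 12^-1 * \sum_(2 <= i < #|S|.+1) (c i ^+ 2 - 1).
Proof.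
move=> m0 c.
rewrite /coherence (trace_path _ m0) big_nat_recr //= big_ltn //.
have first_gap : \sum_(gap_start S 0 <= j < gap_start S 1) resistance R S 0 j =
    (c 1%N ^+ 2 + c 1%N) / 2.
  rewrite /gap_start /= m0 /resistance /c /config /=.
  have := @leader_bounds n S 1 m0; case: (leader S 1) => [//|s] _.
  rewrite subn1 /= -sum_ramp big_add1 big_nat_rev /= [RHS]big_ltn // add0r.
  rewrite [RHS]big_add1; apply: eq_big_nat => j /andP[_ js].
  by rewrite add0n -natrB; [congr _%:R; lia | lia].
have last_gap : \sum_(gap_start S #|S| <= j < gap_start S #|S|.+1)
    resistance R S #|S| j = (c #|S|.+1 ^+ 2 + c #|S|.+1) / 2.
  rewrite /gap_start /= gtn_eqF // leqnn ltnn /resistance gtn_eqF // eqxx.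
  rewrite /c /config eqSS gtn_eqF // eqxx -sum_ramp.
  have /andP[_ ln] : (0 < leader S #|S| <= n)%N by rewrite leader_bounds ?m0 /=.
  rewrite -{1}[leader S _]add0n big_addn subSn //.
  by apply: eq_bigr => j _; rewrite natrD addrK.
have inner_gap i : (1 <= i < #|S|)%N ->
    \sum_(gap_start S i <= j < gap_start S i.+1) resistance R S i j =
    (c i.+1 ^+ 2 - 1) / 6.
  move=> /andP[i0 im]; rewrite /gap_start /= gtn_eqF // im (ltnW im).
  rewrite /resistance gtn_eqF // ltn_eqF //.
  rewrite /c /config /= eqSS gtn_eqF // eqSS ltn_eqF //.
  have lt_l : (leader S i < leader S i.+1)%N by rewrite leader_mono ?ltnSn.
  rewrite -sum_parabola ?subn_gt0 // -{1}[leader S i]add0n big_addn.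
  apply: eq_bigr => j _; rewrite natrD addrK natrB 1?ltnW //.
  by congr (_ * _ / _); ring.
rewrite first_gap last_gap [in RHS]big_add1 /=.
under eq_big_nat => i im do rewrite inner_gap //.
by rewrite -mulr_suml; field.
Qed.

(** * Configurations as lists of lengths *)

Definition gaps (n : nat) (S : {set 'I_n}) : seq nat :=
  pairmap (fun a b => (b - a)%N) (leader S 1) (behead (leaders S)).

Lemma size_gaps (n : nat) (S : {set 'I_n}) : size (gaps S) = (#|S| - 1)%N.
Proof. by rewrite size_pairmap size_behead size_leaders subn1. Qed.

Lemma nth_gaps (n : nat) (S : {set 'I_n}) (i : nat) : (i.+1 < #|S|)%N ->
  nth 0%N (gaps S) i = config S i.+2.
Proof.
move=> im; rewrite /config /= !eqSS ltn_eqF // /gaps /leader.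
have : size (leaders S) = #|S| by exact: size_leaders.
case: (leaders S) => [|a s] /= sz; first by rewrite -sz in im.
by rewrite -sz ltnS in im; rewrite (nth_pairmap 0%N).
Qed.

Definition has_profile (n : nat) (S : {set 'I_n}) (x : nat) (w : seq nat)
    (y : nat) : Prop :=
  [/\ (0 < #|S|)%N, config S 1 = x, gaps S = w & config S #|S|.+1 = y].

Lemma profile_of (n : nat) (S : {set 'I_n}) : (0 < #|S|)%N ->
  has_profile S (config S 1) (gaps S) (config S #|S|.+1).
Proof. by move=> m0; split. Qed.

Lemma profile_sum (n : nat) (S : {set 'I_n}) (x : nat) (w : seq nat) (y : nat) :
  has_profile S x w y -> [/\ size w = (#|S| - 1)%N, all (leq 1) w &
    (x + sumn w + y = n - 1)%N].
Proof.
case=> m0 <- <- <-; rewrite size_gaps; split=> //.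
  apply/(all_nthP 0%N) => i; rewrite size_gaps => im.
  have im1 : (i.+1 < #|S|)%N by lia.
  rewrite nth_gaps // /config /= !eqSS ltn_eqF // subn_gt0.
  by apply: leader_mono; rewrite // ltnSn.
have m1 : (#|S|.+1 == 1)%N = false by rewrite eqSS gtn_eqF.
rewrite /config /= m1 eqxx.
have /andP[l1 _] := @leader_bounds n S 1 m0.
have /andP[_ ln] : (0 < leader S #|S| <= n)%N by rewrite leader_bounds ?m0 /=.
suff sE : (leader S 1 + sumn (gaps S) = leader S #|S|)%N.
  by rewrite -sE in ln *; lia.
(* Positivity of the steps makes the truncated differences exact. *)
have telescope a s : path ltn a s ->
    (a + sumn (pairmap (fun a b => (b - a)%N) a s) = last a s)%N.
  elim: s a => [|b s IHs] a /=; first by rewrite addn0.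
  by move=> /andP[ab /IHs <-]; rewrite addnA subnKC // ltnW.
rewrite /gaps /leader -size_leaders nth_last.
have := size_leaders S; have := leaders_sorted S.
by case: (leaders S) => [|a s] /=; [lia | move=> /telescope ->].
Qed.

Lemma scanl_addn (a : nat) (w : seq nat) : all (leq 1) w ->
  [/\ path ltn a (scanl addn a w),
      {in scanl addn a w, forall j, a <= j <= a + sumn w}%N
    & last a (scanl addn a w) = (a + sumn w)%N].
Proof.
elim: w a => [|c w IHw] a /=; first by rewrite addn0.
case/andP=> c0 /(IHw (a + c)%N) [w_path w_bound w_last].
split; first by rewrite w_path andbT; lia.
  by move=> j; rewrite inE => /predU1P[->|/w_bound]; lia.
by rewrite w_last addnA.
Qed.

Lemma profile_exists (n x : nat) (w : seq nat) (y : nat) : (0 < n)%N ->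
  all (leq 1) w -> (x + sumn w + y = n - 1)%N ->
  exists S : {set 'I_n}, has_profile S x w y.
Proof.
move=> n0 /(scanl_addn x.+1) [s_path s_bound s_last] tot.
pose s := x.+1 :: scanl addn x.+1 w.
pose S := [set v : 'I_n | v.+1 \in s].
have leadersS : leaders S = s.
  apply: (@irr_sorted_eq _ ltn ltn_trans ltnn _ s (leaders_sorted S) s_path) => j.
  apply/mapP/idP => [[v]|js]; first by rewrite mem_enum inE => vs ->.
  have j_bound : (0 < j <= n)%N.
    by move: js; rewrite inE => /predU1P[->|/s_bound]; lia.
  have jn : (j.-1 < n)%N by lia.
  by exists (Ordinal jn); rewrite ?mem_enum ?inE /= prednK //; lia.
have sizeS : #|S| = (size w).+1.
  by rewrite -size_leaders leadersS /= size_scanl.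
exists S; split; first by rewrite sizeS.
- by rewrite /config /leader leadersS /= subn1.
- rewrite /gaps /leader leadersS /=.
  by apply: scanlK => a b; rewrite addKn.
- rewrite /config sizeS eqSS eqxx /leader leadersS /=.
  rewrite -[X in nth _ _ X](size_scanl addn x.+1) (nth_last 0%N (x.+1 :: _)).
  by rewrite /= s_last; lia.
Qed.

(** Twelve times the coherence, which is a natural number. *)
Definition cost (x : nat) (w : seq nat) (y : nat) : nat :=
  (3 * (x * x.+1 + y * y.+1) + \sum_(c <- w) (c ^ 2 - 1))%N.

Lemma coherence_cost (R : realFieldType) (n : nat) (S : {set 'I_n})
    (x : nat) (w : seq nat) (y : nat) :
  has_profile S x w y -> coherence R (@path_graph n) S = (cost x w y)%:R / 12.
Proof.
move=> prof; have [_ w0 _] := profile_sum prof.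
have [m0 xE wE yE] := prof; rewrite coherence_path // xE yE.
have -> : \sum_(2 <= i < #|S|.+1) ((config S i)%:R ^+ 2 - 1) =
    (\sum_(c <- w) (c ^ 2 - 1)%N)%:R :> R.
  rewrite natr_sum !big_add1 [RHS](big_nth 0%N) -wE size_gaps subn1.
  apply: eq_big_nat => i im; rewrite nth_gaps; last by lia.
  have : (0 < config S i.+2)%N.
    rewrite -nth_gaps; last by lia.
    by rewrite wE; apply: (allP w0); rewrite -wE mem_nth // size_gaps; lia.
  by move=> c0; rewrite natrB ?expn_gt0 ?c0 // natrX.
rewrite /cost natrD natrM natrD !natrM -!natr1.
by set T := (\sum_(c <- w) _)%:R; field.
Qed.

(** * Reduction to an optimization over natural numbers *)

(** [N] is the number of edges of the path and [K] the largest number of gaps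
    between leaders, one less than the number of leaders. *)
Definition feasible (N K x : nat) (w : seq nat) (y : nat) : Prop :=
  [/\ (size w <= K)%N, all (leq 1) w & (x + sumn w + y = N)%N].

Definition minimal (N K x : nat) (w : seq nat) (y : nat) : Prop :=
  feasible N K x w y /\
  forall x' w' y', feasible N K x' w' y' -> (cost x w y <= cost x' w' y')%N.

Lemma optimal_minimal (R : realFieldType) (n k : nat) (S : {set 'I_n})
    (x : nat) (w : seq nat) (y : nat) :
  (0 < n)%N -> (0 < k)%N -> has_profile S x w y ->
  optimal_leaders R (@path_graph n) k S <-> minimal (n - 1) (k - 1) x w y.
Proof.
move=> n0 k0 prof; have [sizew w0 tot] := profile_sum prof.
have [m0 _ _ _] := prof.
have le_cost x' w' y' (S' : {set 'I_n}) : has_profile S' x' w' y' ->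
    (coherence R (@path_graph n) S <= coherence R (@path_graph n) S') =
    (cost x w y <= cost x' w' y')%N.
  move=> prof'; rewrite (coherence_cost R prof) (coherence_cost R prof').
  by rewrite ler_pM2r ?invr_gt0 ?ltr0n // ler_nat.
split=> [[mk opt]|[[mk _ _] opt]].
  split=> [|x' w' y' [sz' w0' tot']]; first by split=> //; rewrite sizew; lia.
  have [S' prof'] := profile_exists n0 w0' tot'.
  have [sizew' _ _] := profile_sum prof'; have [m0' _ _ _] := prof'.
  by rewrite -(le_cost _ _ _ S') //; apply: opt; lia.
split; first by lia.
move=> S' /andP[m0' mk']; have prof' := profile_of m0'.
have [sizew' w0' tot'] := profile_sum prof'.
by rewrite (le_cost _ _ _ _ prof'); apply: opt; split=> //; lia.
Qed.

Lemma cost_cons (x c : nat) (w : seq nat) (y : nat) :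
  cost x (c :: w) y = (cost x w y + (c ^ 2 - 1))%N.
Proof. by rewrite /cost big_cons; lia. Qed.

Lemma cost_perm (x : nat) (w w' : seq nat) (y : nat) :
  perm_eq w w' -> cost x w y = cost x w' y.
Proof. by move=> ww'; rewrite /cost (perm_big _ ww'). Qed.

(** * Convexity of the cost *)

(** Adding [size w] removes the truncated subtractions from the cost. *)
Lemma cost_squares (x : nat) (w : seq nat) (y : nat) : all (leq 1) w ->
  (cost x w y + size w = 3 * (x * x.+1 + y * y.+1) + \sum_(c <- w) c ^ 2)%N.
Proof.
rewrite /cost -addnA => w0; congr addn.
elim: w w0 => [|c w IHw] /= => [_|/andP[c0 /IHw IH]]; first by rewrite !big_nil.
rewrite !big_cons -IH; have : (0 < c ^ 2)%N by rewrite expn_gt0 c0.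
by lia.
Qed.

(** The parabola lies above its tangent at [c]. *)
Lemma squares_tangent (c : nat) (w : seq nat) :
  (2 * (c * sumn w) <= \sum_(d <- w) d ^ 2 + size w * c ^ 2 ?= iff
     all (pred1 c) w)%N.
Proof.
elim: w => [|d w IHw] /=; first by rewrite big_nil; split; rewrite ?muln0.
rewrite big_cons (mulnDr c) (mulnDr 2) mulSn addnACA.
by apply: leqif_add => //; rewrite [(c * d)%N]mulnC; apply: nat_Cauchy.
Qed.

(** With fewer gaps than allowed, some segment can be split: cutting a unit gap
    off an end, or off a gap of length at least 2, lowers the cost.  Such a gap
    exists when both ends are empty, since otherwise the gaps are too few to
    fill the path. *)
Lemma minimal_size (N K x : nat) (w : seq nat) (y : nat) :
  (K <= N)%N -> minimal N K x w y -> size w = K.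
Proof.
move=> KN [[wK w0 tot] opt]; apply/eqP; rewrite eqn_leq wK leqNgt /=.
apply/negP => lt_wK.
case: x tot opt => [|x] tot opt; last first.
  suff: (cost x.+1 w y <= cost x (1%N :: w) y)%N by rewrite cost_cons /cost; lia.
  by apply: opt; split=> //=; lia.
case: y tot opt => [|y] tot opt; last first.
  suff: (cost 0 w y.+1 <= cost 0 (1%N :: w) y)%N by rewrite cost_cons /cost; lia.
  by apply: opt; split=> //=; lia.
have [c cw c2] : exists2 c : nat, c \in w & (1 < c)%N.
  have [all1|/allPn[c cw c2]] := boolP (all (geq 1) w); last first.
    by exists c; rewrite // ltnNge.
  suff : (sumn w <= size w)%N by lia.
  by elim: w all1 {w0 wK tot opt lt_wK} => //= c w IHw /andP[c1 /IHw]; lia.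
have rem_c := perm_to_rem cw; have sumw := perm_sumn rem_c.
have szw := perm_size rem_c; rewrite /= in sumw szw.
move: w0; rewrite (perm_all _ rem_c) /= => /andP[c0 w0].
suff: (cost 0 w 0 <= cost 0 [:: c.-1, 1%N & rem c w] 0)%N.
  rewrite (cost_perm _ _ rem_c) !cost_cons; nia.
by apply: opt; split=> /=; [lia | rewrite w0 andbT; lia | lia].
Qed.

(** The parabola [3 t (t + 1)] lies above the line of slope [2 c] through its
    point at [x], at integers only: the chords of the parabola on either side
    of [x] have slopes [6 x] and [6 x + 6]. *)
Lemma end_tangent (x c t : nat) : (3 * x <= c <= 3 * x + 3)%N ->
  (3 * (x * x.+1) + 2 * (c * t) <= 3 * (t * t.+1) + 2 * (c * x))%N.
Proof.
move=> /andP[xc cx]; case: (leqP x t) => [le_xt|lt_tx].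
  rewrite -(subnKC le_xt); set d := (t - x)%N; nia.
rewrite -(subnKC lt_tx); set d := (x - t.+1)%N in lt_tx *; nia.
Qed.

Lemma cost_balanced (K x c : nat) : (0 < c)%N ->
  (cost x (nseq K c) x + K = 6 * (x * x.+1) + K * c ^ 2)%N.
Proof.
move=> c0; have := @cost_squares x (nseq K c) x.
rewrite size_nseq all_nseq c0 orbT => -> //.
suff -> : (\sum_(d <- nseq K c) d ^ 2 = K * c ^ 2)%N by lia.
by rewrite big_nseq iter_addn_0 mulnC.
Qed.

(** The slope [2 c] is the same in the tangent bounds for the ends and for the
    gaps, so that summing them leaves only the fixed total length.  Missing gaps
    count as gaps of length zero, each of which loses [c ^ 2 + 1].  For
    uniqueness, equality in [end_tangent] does not determine the ends, but
    equality for the gaps does; the ends then have the right sum, and their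
    squares too. *)
Lemma balanced_cost_min (K x c x' : nat) (w : seq nat) (y' : nat) :
  (0 < c)%N -> (3 * x <= c <= 3 * x + 3)%N ->
  feasible (x + K * c + x) K x' w y' ->
  (cost x (nseq K c) x <= cost x' w y')%N /\
  (cost x (nseq K c) x = cost x' w y' -> [/\ x' = x, w = nseq K c & y' = x]).
Proof.
move=> c0 xc [wK w0 tot].
have bal := cost_balanced K x c0; have sq := cost_squares x' y' w0.
have [tan tan_eq] := squares_tangent c w.
have tx := end_tangent x' xc; have ty := end_tangent y' xc.
have : (c * (x' + sumn w + y') = c * (x + K * c + x))%N by rewrite tot.
rewrite !mulnDr => tot_c.
(* What follows is linear in the products, once these are normalized. *)
have szc : (size w * c ^ 2 + size w <= K * c ^ 2 + K)%N by nia.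
have KcE : (c * (K * c) = K * c ^ 2)%N by nia.
split=> [|cost_eq]; first by lia.
have szE : size w = K by nia.
have wE : w = nseq K c.
  rewrite -szE; apply/all_pred1P; rewrite -tan_eq; apply/eqP; rewrite szE in tan *; lia.
have xy : (x' + y' = x + x)%N.
  by move: tot; rewrite wE sumn_nseq; lia.
by split=> //; nia.
Qed.

(** * The optimal configuration *)

(** The balanced configuration keeps the total length [2 a] of the ends and the
    total [K c] of the gaps, and sums of squares with given sum are least when
    all terms are equal. *)
Lemma minimal_balanced (N K x : nat) (w : seq nat) (y : nat) :
  (0 < K <= N)%N -> minimal N K x w y ->
  (2 %| x + y)%N -> (K %| N - (x + y))%N ->
  exists a c : nat, [/\ (0 < c)%N, N = (a + K * c + a)%N &
    minimal N K a (nseq K c) a].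
Proof.
move=> /andP[K0 KN] min_w; have szw := minimal_size KN min_w.
have [[wK w0 tot] opt] := min_w.
move=> /dvdnP[a aE] /dvdnP[c cE].
have sumw : sumn w = (K * c)%N by lia.
have c0 : (0 < c)%N.
  rewrite lt0n; apply: contraTneq K0 => c0.
  have : (size w <= sumn w)%N.
    by elim: w w0 {szw tot opt sumw wK min_w} => //= d w IHw /andP[d0 /IHw]; lia.
  by rewrite szw sumw c0 muln0 lt0n leqn0 => ->.
have balN : N = (a + K * c + a)%N by lia.
exists a, c; split=> //; split.
  by split; rewrite ?size_nseq ?all_nseq ?c0 ?orbT // sumn_nseq; lia.
move=> x' w' y' /opt; apply: leq_trans.
have bal := cost_balanced K a c0; have sq := cost_squares x y w0.
have [tan _] := squares_tangent c w.
rewrite szw in sq tan; rewrite sumw in tan.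
have xy : (2 * (a * a.+1) <= x * x.+1 + y * y.+1)%N.
  have {}aE : (x + y = a + a)%N by lia.
  have [dxy _] := nat_Cauchy x y; nia.
have KcE : (c * (K * c) = K * c ^ 2)%N by nia.
lia.
Qed.

(** Moving one unit from an end to one gap changes the cost by
    [2 c + 1 - 6 x], and from a gap to an end by [6 x + 7 - 2 c].  When the move
    is possible this odd number cannot be negative; when the end is empty or the
    gap has length 1, the bound is immediate. *)
Lemma minimal_gap_bounds (N K x c : nat) : (0 < K)%N -> (0 < c)%N ->
  minimal N K x (nseq K c) x -> (3 * x <= c <= 3 * x + 3)%N.
Proof.
case: K => // K _ c0 [[_ /= /andP[_ w0] tot] opt].
have exchange x' c' : (0 < c')%N -> (x' + c' = x + c)%N ->
    (cost x (nseq K.+1 c) x <= cost x' (c' :: nseq K c) x)%N.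
  move=> c'0 xc; apply: opt; split=> /=; first by rewrite size_nseq.
    by rewrite c'0.
  lia.
apply/andP; split.
  case: x exchange {tot opt} => // x /(_ x c.+1 isT).
  rewrite addnS addSn => /(_ erefl).
  by rewrite /= !cost_cons /cost; nia.
case: c c0 exchange {tot opt w0} => [|[|c]] // _ exchange; first by lia.
have := exchange x.+1 c.+1 isT; rewrite !addnS !addSn => /(_ erefl).
by rewrite /= !cost_cons /cost; nia.
Qed.

(** The difference between the quotient and [x] is
    [K (2 c - 6 x - 3) / (6 K + 4)], of absolute value at most
    [3 K / (6 K + 4) < 1 / 2]. *)
Lemma round_balanced (R : archiRealFieldType) (N K x c : nat) : (0 < K)%N ->
  N = (x + K * c + x)%N -> (3 * x <= c <= 3 * x + 3)%N ->
  round ((2 * N%:R - 3 * K%:R) / (6 * K%:R + 4) : R) = x%:Z.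
Proof.
move=> K0 -> /andP[xc cx]; rewrite !natrD natrM.
have lo : 3 * x%:R <= c%:R :> R by rewrite -natrM ler_nat.
have hi : c%:R <= 3 * x%:R + 3 :> R by rewrite -natrM -natrD ler_nat.
have K1 : 0 < K%:R :> R by rewrite ltr0n.
have D0 : 0 < 6 * K%:R + 4 :> R by lra.
apply: floor_def; rewrite intrD mulr1z -!pmulrn.
set q := _ / _.
have qE : q * (6 * K%:R + 4) =
    x%:R * (6 * K%:R + 4) + K%:R * (2 * c%:R - 6 * x%:R - 3).
  by rewrite /q divfK ?gt_eqF //; ring.
have t_ge : -3 <= 2 * c%:R - 6 * x%:R - 3 :> R by lra.
have t_le : 2 * c%:R - 6 * x%:R - 3 <= 3 :> R by lra.
set t := 2 * c%:R - 6 * x%:R - 3 in qE t_ge t_le.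
have Kt_ge : K%:R * (-3) <= K%:R * t by rewrite ler_pM2l.
have Kt_le : K%:R * t <= K%:R * 3 by rewrite ler_pM2l.
have : (x%:R - 2^-1) * (6 * K%:R + 4) <= q * (6 * K%:R + 4) by rewrite qE; lra.
have : q * (6 * K%:R + 4) < (x%:R + 2^-1) * (6 * K%:R + 4) by rewrite qE; lra.
rewrite ltr_pM2r // ler_pM2r //; lra.
Qed.

Theorem theorem10 (R : archiRealFieldType) (n k : nat)
    (k_ge2 : (2 <= k)%N) (k_le_n : (k <= n)%N) :
  (forall S : {set 'I_n}, #|S| = k ->
     let c i : R := (config S i)%:R in
     coherence R (@path_graph n) S =
       4^-1 * (c 1%N ^+ 2 + c k.+1 ^+ 2 + c 1%N + c k.+1)
       + 12^-1 * \sum_(2 <= i < k.+1) (c i ^+ 2 - 1))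
  /\
  ((exists2 S : {set 'I_n}, optimal_leaders R (@path_graph n) k S &
      exists a : nat,
        [/\ (config S 1 + config S k.+1)%N = a,
            (2 %| a)%N &
            (k - 1 %| (n - 1) - a)%N]) ->
   forall S : {set 'I_n},
     optimal_leaders R (@path_graph n) k S <->
     [/\ #|S| = k,
         (config S 1)%:Z =
           round ((2 * (n%:R - 1) - 3 * (k%:R - 1)) / (6 * (k%:R - 1) + 4) : R),
         config S k.+1 = config S 1 &
         forall i : nat, (2 <= i <= k)%N ->
           (config S i)%:R =
             (k%:R - 1)^-1 * ((n%:R - 1) - 2 * (config S 1)%:R) :> R]).
Proof.
split=> [S Sk c|]; first by rewrite -Sk coherence_path // Sk ltnW.
have n0 : (0 < n)%N by lia.
have k0 : (0 < k)%N by lia.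
have K0 : (0 < k - 1)%N by lia.
have KN : (k - 1 <= n - 1)%N by lia.
have kR : k%:R - 1 = (k - 1)%:R :> R by rewrite natrB.
have nR : n%:R - 1 = (n - 1)%:R :> R by rewrite natrB.
have opt_profile (S : {set 'I_n}) : optimal_leaders R (@path_graph n) k S ->
    #|S| = k /\ minimal (n - 1) (k - 1) (config S 1) (gaps S) (config S k.+1).
  move=> opt; have /andP[m0 mk] := opt.1.
  have min_S := (optimal_minimal R n0 k0 (profile_of m0)).1 opt.
  have Sk : #|S| = k by have := minimal_size KN min_S; rewrite size_gaps; lia.
  by rewrite Sk in min_S.
case=> S0 /opt_profile[S0k min_S0] [a [aE a_even a_div]].
rewrite -aE in a_even a_div.
have [x [c [c0 nE bal_min]]] :=
  minimal_balanced (introT andP (conj K0 KN)) min_S0 a_even a_div.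
have xc := minimal_gap_bounds K0 c0 bal_min.
have round_x := round_balanced R K0 nE xc.
have gapE : (k - 1)%:R^-1 * ((n - 1)%:R - 2 * x%:R) = c%:R :> R.
  rewrite nE !natrD natrM; field.
  by rewrite pnatr_eq0 -lt0n.
rewrite kR nR round_x => S; split=> [/opt_profile[Sk [feas_S min_S]]|].
  have [|cost_le cost_eq] := balanced_cost_min c0 xc (x' := config S 1)
    (w := gaps S) (y' := config S k.+1) (K := (k - 1)%N).
    by rewrite -nE.
  have [|xE wE yE] := cost_eq.
    by apply/eqP; rewrite eqn_leq cost_le min_S //; case: bal_min.
  split=> //; rewrite ?xE ?yE // => i /andP[i2 ik].
  rewrite gapE; case: i i2 ik => [|[|i]] // _ ik.
  by rewrite -nth_gaps ?Sk // wE nth_nseq ifT //; lia.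
case=> Sk [xE] yE; rewrite xE in yE * => gapS.
have m0 : (0 < #|S|)%N by rewrite Sk.
apply/(optimal_minimal R n0 k0 (profile_of m0)).
rewrite xE Sk yE; have -> // : gaps S = nseq (k - 1) c.
apply: (@eq_from_nth _ 0%N) => [|i]; first by rewrite size_gaps Sk size_nseq.
rewrite size_gaps Sk => ik; rewrite nth_nseq ik nth_gaps; last by rewrite Sk; lia.
by apply/eqP; rewrite -(eqr_nat R) gapS ?gapE //; lia.
Qed.
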